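(* Let $(\tilde X,\tilde B,\Lambda)$ be the initial seed of a quantum cluster algebra $A_q$ and $\{-,-\}$ a Poisson bracket on $A_q$ for which the initial extended cluster is log-canonical with Poisson matrix $\Omega=(\omega_{ij})$. Suppose $\tilde B$ has the decomposition $\tilde B=\bigsqcup_{i=1}^r\tilde B_{I_i}$ with $\tilde B_{I_i}$ indecomposable for $i\in[1,r]$. For $i\in[1,r]$ let $A_{q,I_i}$ be the quantum cluster subalgebra of $A_q$ generated by $(\tilde B_{I_i},\Lambda_{I_i})$, and for $k\in[1,n]$ let $I(k)$ be the one of the sets $I_1,\dots,I_r$ containing $k$. Then $\{-,-\}$ is compatible with $A_q$ if and only if the restriction $\{-,-\}|_{A_{q,I_i}}$ is compatible with $A_{q,I_i}$ for every $i\in[1,r]$ and $$\sum_{t:\,\lambda_{tj}=0}\omega_{tj}b_{tk}=0\qquad\text{for all }k\in[1,n],\ j\in[1,m]\setminus I(k).$$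
   Context: Notation: $[1,m]=\{1,\dots,m\}$; $[a]_+=\max\{a,0\}$, applied componentwise to vectors. Fix $n\le m$. Quantum cluster algebras. $\tilde B=(b_{ij})$ is an $m\times n$ integer matrix whose top $n\times n$ part $B$ is skew-symmetrizable: there is a positive diagonal matrix $D$ (a skew-symmetrizer) with $DB$ skew-symmetric. $\Lambda=(\lambda_{ij})$ is a skew-symmetric $m\times m$ integer matrix such that $(\tilde B,\Lambda)$ is a compatible pair: $\tilde B^\top\Lambda=(D\ \ O)$. Let $q$ be a formal variable. The quantum torus is the $\mathbb Z[q^{\pm 1/2}]$-algebra with basis $X^e$ ($e\in\mathbb Z^m$) and product $X^eX^f=q^{\frac12 e^\top\Lambda f}X^{e+f}$; $\mathscr F_q$ is its skew-field of fractions; $X_i=X^{e_i}$ with $e_i$ the standard basis. A quantum seed is $(\tilde X,\tilde B,\Lambda)$ with extended cluster $\tilde X=(X_1,\dots,X_m)$; $X_1,\dots,X_n$ are cluster variables and $X_{n+1},\dots,X_m$ are frozen. For $k\in[1,n]$ the mutation $\mu_k$ replaces $X_k$ by $X_k'=X^{-e_k+[b_k]_+}+X^{-e_k+[-b_k]_+}$ ($b_k$ the $k$-th column of $\tilde B$), replaces $\tilde B$ by $\tilde B'$ with $b'_{ij}=-b_{ij}$ if $i=k$ or $j=k$ and $b'_{ij}=b_{ij}+\mathrm{sgn}(b_{ik})[b_{ik}b_{kj}]_+$ otherwise, and replaces $\Lambda$ by the skew-symmetric $\Lambda'$ with $\lambda'_{kj}=-\lambda_{kj}+\sum_{l=1}^m[b_{lk}]_+\lambda_{lj}$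 for $j\ne k$ and $\lambda'_{ij}=\lambda_{ij}$ for $i,j\neq k$. The result is again a quantum seed, whose normalized monomials $X'^e$ satisfy the same relation with $\Lambda'$. $A_q$ is the $\mathbb Z[q^{\pm1/2}][X_{n+1}^{\pm1},\dots,X_m^{\pm1}]$-subalgebra of $\mathscr F_q$ generated by all cluster variables of all seeds obtained by iterated mutation. Poisson structures. A Poisson structure (Poisson bracket) on an associative algebra over $k=\mathbb Z[q^{\pm1/2}]$ is a $k$-bilinear Lie bracket with $\{a,bc\}=\{a,b\}c+b\{a,c\}$ (the algebra need not be commutative). An extended cluster $\tilde X$ is log-canonical with respect to $\{-,-\}$ if $\{X_i,X_j\}=\omega_{ij}X^{e_i+e_j}$ with $\omega_{ij}\in\mathbb Z[q^{\pm1/2}]$ for all $i,j$; then $\Omega=(\omega_{ij})$ is its Poisson matrix. $\{-,-\}$ is compatible with a quantum cluster algebra if all its extended clusters are log-canonical. Decomposition. $\tilde B$ is decomposable if there is a nontrivial partition $[1,m]=I_1\sqcup I_2$ with $b_{ij}=0$ whenever $i,j$ lie in different parts ($i\in[1,m]$, $j\in[1,n]$); one writes $\tilde B=\tilde B_{I_1}\sqcup\tilde B_{I_2}$, where $\tilde B_{I}$ is the submatrix with rows $I$ and columns $I\cap[1,n]$; similarly for more parts. Otherwise $\tilde B$ is indecomposable. $\Lambda_I$ is the submatrix of $\Lambda$ on $I\times I$, and $A_{q,I}$ is the quantum cluster algebra with initial seed $((X_i)_{i\in I},\tilde B_I,\Lambda_I)$. *)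

(* Defs.v *)
From HB Require Import structures.
From mathcomp Require Import all_boot all_order all_algebra.

Set Implicit Arguments.
Unset Strict Implicit.
Unset Printing Implicit Defensive.
Import Order.TTheory GRing.Theory Num.Theory.
Local Open Scope ring_scope.

(* Conventions.
   - h stands for q^{1/2}; the number m >= n of rows is written n + p, so the
     mutable indices are [lshift p k] with k : 'I_n and the frozen ones are
     [rshift n j] with j : 'I_p.
   - Z[q^{+-1/2}] and all algebras are subsets (F -> Prop) of one skew field F.
   - Exponent vectors e in Z^m are columns 'cV[int]_m. *)

Definition pos_part (a : int) : int := Num.max a 0.

Definition pairing (m : nat) (L : 'M[int]_m) (e f : 'cV[int]_m) : int :=
  (e^T *m L *m f) 0 0.

Section QuantumTorus.
Variable F : unitRingType.
Implicit Types (h x y : F).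

Definition laurent_scalar h x : Prop :=
  exists (N : nat) (P : {poly int}), x = h ^- N * (map_poly intr P).[h].

Definition in_quantum_torus h (m : nat) (X : 'cV[int]_m -> F) x : Prop :=
  exists (s : seq 'cV[int]_m) (c : 'cV[int]_m -> F),
    (forall e, laurent_scalar h (c e)) /\ x = \sum_(e <- s) c e * X e.

(* F is a skew field of fractions of the quantum torus attached to L, whose
   basis is the family X.  This determines (F, h, X) up to isomorphism. *)
Record quantum_torus_skew_field h (m : nat) (L : 'M[int]_m)
    (X : 'cV[int]_m -> F) : Prop := QuantumTorusSkewField {
  qt_division : forall x, x != 0 -> x \is a GRing.unit;
  qt_central : forall x, h * x = x * h;
  qt_formal : forall P : {poly int}, (map_poly intr P).[h] = 0 :> F -> P = 0;
  qt_mul : forall e f, X e * X f = h ^ pairing L e f * X (e + f);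
  qt_free : forall (s : seq 'cV[int]_m) (c : 'cV[int]_m -> F),
    uniq s -> (forall e, laurent_scalar h (c e)) ->
    \sum_(e <- s) c e * X e = 0 -> forall e, e \in s -> c e = 0;
  qt_fractions : forall x, exists a b,
    [/\ in_quantum_torus h X a, in_quantum_torus h X b, b != 0
      & x = a * b^-1]
}.

(* X^e expressed through X_1, ..., X_m: the relation
   X^e X^f = q^{1/2 e^T L f} X^{e+f} forces
   X_1^{e_1} ... X_m^{e_m} = q^{1/2 sum_{i<j} e_i e_j l_ij} X^e. *)
Definition normalized_monomial h (m : nat) (L : 'M[int]_m)
    (x : {ffun 'I_m -> F}) (e : 'cV[int]_m) : F :=
  h ^ (- \sum_(i < m) \sum_(j < m | (i < j)%N) e i 0 * e j 0 * L i j)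
  * \prod_(i < m) x i ^ e i 0.

End QuantumTorus.

Definition compatible_pair (n p : nat) (B : 'M[int]_(n + p, n))
    (L : 'M[int]_(n + p)) : Prop :=
  exists D : 'rV[int]_n,
    [/\ forall k, 0 < D 0 k,
        (diag_mx D *m usubmx B)^T = - (diag_mx D *m usubmx B),
        L^T = - L
      & B^T *m L = row_mx (diag_mx D) 0].

Record qseed (F : unitRingType) (n p : nat) := QSeed {
  extended_cluster : {ffun 'I_(n + p) -> F};
  exchange_matrix : 'M[int]_(n + p, n);
  quasi_commutation : 'M[int]_(n + p)
}.

Definition initial_seed (F : unitRingType) (n p : nat)
    (X : 'cV[int]_(n + p) -> F) (B : 'M[int]_(n + p, n))
    (L : 'M[int]_(n + p)) : qseed F n p :=
  QSeed [ffun i => X (delta_mx i 0)] B L.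

Section Mutation.
Variables (n p : nat).

Definition mutate_exchange (B : 'M[int]_(n + p, n)) (k : 'I_n) :
    'M[int]_(n + p, n) :=
  \matrix_(i, j)
    if (i == lshift p k) || (j == k) then - B i j
    else B i j + Num.sg (B i k) * pos_part (B i k * B (lshift p k) j).

Definition mutate_commutation (B : 'M[int]_(n + p, n)) (L : 'M[int]_(n + p))
    (k : 'I_n) : 'M[int]_(n + p) :=
  let row_k j := - L (lshift p k) j + \sum_l pos_part (B l k) * L l j in
  \matrix_(i, j)
    if i == lshift p k then (if j == lshift p k then 0 else row_k j)
    else if j == lshift p k then - row_k i
    else L i j.

Variables (F : unitRingType) (h : F).
Implicit Type s : qseed F n p.

Definition seed_monomial s (e : 'cV[int]_(n + p)) : F :=
  normalized_monomial h (quasi_commutation s) (extended_cluster s) e.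

Definition mutate_variable s (k : 'I_n) : F :=
  let e_k : 'cV[int]_(n + p) := delta_mx (lshift p k) 0 in
  let b_k := col k (exchange_matrix s) in
  seed_monomial s (- e_k + map_mx pos_part b_k)
  + seed_monomial s (- e_k + map_mx pos_part (- b_k)).

Definition mutate s (k : 'I_n) : qseed F n p :=
  QSeed [ffun i => if i == lshift p k then mutate_variable s k
                   else extended_cluster s i]
        (mutate_exchange (exchange_matrix s) k)
        (mutate_commutation (exchange_matrix s) (quasi_commutation s) k).

Definition mutations s (ks : seq 'I_n) : qseed F n p := foldl mutate s ks.

(* The quantum cluster algebra with initial seed s, as a subset of F. *)
Inductive cluster_algebra s : F -> Prop :=
| cluster_algebra_scalar c : laurent_scalar h c -> cluster_algebra s c
| cluster_algebra_frozen (j : 'I_p) :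
    cluster_algebra s (extended_cluster s (rshift n j))
| cluster_algebra_frozenV (j : 'I_p) :
    cluster_algebra s (extended_cluster s (rshift n j))^-1
| cluster_algebra_variable (ks : seq 'I_n) (k : 'I_n) :
    cluster_algebra s (extended_cluster (mutations s ks) (lshift p k))
| cluster_algebra_add x y :
    cluster_algebra s x -> cluster_algebra s y -> cluster_algebra s (x + y)
| cluster_algebra_mul x y :
    cluster_algebra s x -> cluster_algebra s y -> cluster_algebra s (x * y).

Definition log_canonical (br : F -> F -> F) s (W : 'M[F]_(n + p)) : Prop :=
  forall i j, laurent_scalar h (W i j) /\
    br (extended_cluster s i) (extended_cluster s j)
      = W i j * seed_monomial s (delta_mx i 0 + delta_mx j 0).

(* Compatibility of a bracket with the quantum cluster algebra with initial
   seed s: all its extended clusters are log-canonical.  Only values of br on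
   that algebra are involved, so for the initial seed of a subalgebra this is
   compatibility of the restricted bracket. *)
Definition compatible (br : F -> F -> F) s : Prop :=
  forall ks : seq 'I_n, exists W, log_canonical br (mutations s ks) W.

End Mutation.

(* A bracket on the subalgebra A is given by a map on F of which only the
   values on A x A are constrained. *)
Record poisson_bracket (F : unitRingType) (h : F) (A : F -> Prop)
    (br : F -> F -> F) : Prop := PoissonBracket {
  pb_closed : forall a b, A a -> A b -> A (br a b);
  pb_linearl : forall c a b d, laurent_scalar h c -> A a -> A b -> A d ->
    br (c * a + b) d = c * br a d + br b d;
  pb_linearr : forall c a b d, laurent_scalar h c -> A a -> A b -> A d ->
    br d (c * a + b) = c * br d a + br d b;
  pb_alternating : forall a, A a -> br a a = 0;
  pb_jacobi : forall a b c, A a -> A b -> A c ->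
    br a (br b c) + br b (br c a) + br c (br a b) = 0;
  pb_leibniz : forall a b c, A a -> A b -> A c ->
    br a (b * c) = br a b * c + b * br a c
}.

Section Decomposition.
Variables (n p : nat).
Implicit Types (B : 'M[int]_(n + p, n)) (I : {set 'I_(n + p)}).

Definition decomposition B (P : {set {set 'I_(n + p)}}) : Prop :=
  partition P [set: 'I_(n + p)] /\
  forall i j, pblock P i != pblock P (lshift p j) -> B i j = 0.

Definition mutable_part I : {set 'I_n} := [set k | lshift p k \in I].
Definition frozen_part I : {set 'I_p} := [set j | rshift n j \in I].

(* The increasing bijection from {0, ..., |I| - 1} onto I, mutable indices
   first. *)
Definition part_index I (i : 'I_(#|mutable_part I| + #|frozen_part I|)) :
    'I_(n + p) :=
  match split i with
  | inl k => lshift p (enum_val k)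
  | inr j => rshift n (enum_val j)
  end.

Definition part_exchange I B :
    'M[int]_(#|mutable_part I| + #|frozen_part I|, #|mutable_part I|) :=
  mxsub (@part_index I) enum_val B.

Definition part_seed (F : unitRingType) I (s : qseed F n p) :
    qseed F #|mutable_part I| #|frozen_part I| :=
  QSeed [ffun i => extended_cluster s (part_index i)]
        (part_exchange I (exchange_matrix s))
        (mxsub (@part_index I) (@part_index I) (quasi_commutation s)).

End Decomposition.

Definition decomposable (n p : nat) (B : 'M[int]_(n + p, n)) : Prop :=
  exists P : {set {set 'I_(n + p)}}, #|P| = 2%N /\ decomposition B P.

(* Main.v *)
(* Expanding {ab, cd} by the Leibniz rule in both arguments, in the two possible
   orders, gives {a,c}[b,d] = [a,c]{b,d} (Farkas and Letzter).  If n > 0, then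
   B^T L = (D 0) with D > 0 provides initial variables X_t, X_k that do not
   commute, so the bracket is a central multiple a[-,-] of the commutator on the
   whole of A_q.  Each seed quasi-commutes with its own matrix L', and the
   integers z for which a (h^z - h^-z) is a Laurent polynomial form a subgroup
   containing the entries of L, hence those of every L'.  So every bracket that
   is log-canonical on the initial extended cluster is compatible, and
   omega_tj = 0 whenever l_tj = 0. *)
Require Import Defs.
From mathcomp Require Import all_boot all_order all_algebra zify.
Import Order.TTheory GRing.Theory Num.Theory.
Local Open Scope ring_scope.
Set Implicit Arguments.
Unset Strict Implicit.
Unset Printing Implicit Defensive.

(** * Increasing enumerations and normalized monomials with restricted support *)

Lemma sorted_enum_ord m (A : {pred 'I_m}) :
  sorted (fun i j : 'I_m => (i < j)%N) (enum A).
Proof.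
have srt : sorted (fun i j : 'I_m => (i < j)%N) (enum 'I_m).
  have := iota_ltn_sorted 0 m; rewrite -val_enum_ord sorted_map.
  by apply: sub_sorted.
have -> : enum A = [seq i <- enum 'I_m | i \in A].
  by rewrite {1}/enum_mem; congr filter; rewrite enumT.
by apply: sorted_filter srt => ? ? ?; apply: ltn_trans.
Qed.

Lemma ltn_enum_val m (A : {pred 'I_m}) (i j : 'I_#|A|) :
  (i < j)%N -> (enum_val i < enum_val j)%N.
Proof.
move=> ij; have x0 : 'I_m by exact: enum_val i.
have tr : transitive (fun i j : 'I_m => (i < j)%N).
  by move=> ? ? ?; apply: ltn_trans.
have /(_ i j) := sorted_ltn_nth tr x0 (sorted_enum_ord A).
by rewrite !inE -cardE !ltn_ord -!enum_val_nth => /(_ isT isT ij).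
Qed.

(** Strictly increasing lists are determined by their members. This lets an ordered product over a
    subset be rewritten over an explicit list. *)
Lemma eq_enum_ord m (A : {pred 'I_m}) (r : seq 'I_m) :
  sorted (fun i j : 'I_m => (i < j)%N) r -> A =i r -> enum A = r.
Proof.
move=> sr Ar; apply: (irr_sorted_eq _ _ (sorted_enum_ord A) sr).
- by move=> ? ? ?; apply: ltn_trans.
- by move=> ?; rewrite /= ltnn.
- by move=> i; rewrite mem_enum Ar.
Qed.

(* The product is ordered, so the factors may be dropped but not permuted. *)
Lemma normalized_monomial_support (F : unitRingType) (h : F) m (L : 'M[int]_m)
    (x : {ffun 'I_m -> F}) (e : 'cV[int]_m) (A : {pred 'I_m}) :
  (forall i, i \notin A -> e i 0 = 0) ->
  normalized_monomial h L x e =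
  h ^ (- \sum_(i <- enum A) \sum_(j <- enum A | (i < j)%N) e i 0 * e j 0 * L i j)
  * \prod_(i <- enum A) x i ^ e i 0.
Proof.
move=> e0; rewrite /normalized_monomial /enum_mem -enumT; congr (h ^ (- _) * _).
  rewrite big_filter [RHS]big_mkcond enumT; apply: eq_bigr => i _.
  case: ifP => [_|/negbT Ai]; last first.
    by apply: big1 => j _; rewrite (e0 i Ai) !mul0r.
  rewrite [in LHS]big_mkcond [in RHS]big_mkcond big_filter [RHS]big_mkcond.
  apply: eq_bigr => j _; case: ifP => [_|_]; last by case: ifP.
  by case: ifP => // /negbT Aj; rewrite (e0 j Aj) mulr0 mul0r.
rewrite big_filter [RHS]big_mkcond enumT; apply: eq_bigr => i _.
by case: ifP => // /negbT Ai; rewrite (e0 i Ai).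
Qed.

Lemma normalized_monomial_pair (F : unitRingType) (h : F) m (L : 'M[int]_m)
    (x : {ffun 'I_m -> F}) (i j : 'I_m) : (i < j)%N ->
  normalized_monomial h L x (delta_mx i 0 + delta_mx j 0) =
  h ^ (- L i j) * (x i * x j).
Proof.
move=> ij; have nij : i == j = false by apply/eqP => eij; rewrite eij ltnn in ij.
rewrite (@normalized_monomial_support _ _ _ _ _ _ (pred2 i j)); last first.
  by move=> l; rewrite !inE !mxE negb_or => /andP[/negPf-> /negPf->].
rewrite (@eq_enum_ord _ (pred2 i j) [:: i; j]) /= ?ij//; last first.
  by move=> l; rewrite !inE.
rewrite !big_cons !big_nil ij !ltnn ltnNge (ltnW ij) /= !mxE !eqxx nij.
by rewrite eq_sym nij !addr0 add0r mulr1 !expr1z mulr1 mul1r.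
Qed.

(** * Restriction of a seed to one part of a decomposition *)

Section PartIndex.
Variables (n p : nat) (I : {set 'I_(n + p)}).
Local Notation a := #|mutable_part I|.
Local Notation b := #|frozen_part I|.

(** Mutable indices precede frozen ones on both sides, and [enum_val] is increasing on each kind.
    Order matters because the factors of a normalized monomial do not commute. *)
Lemma part_index_homo (i j : 'I_(a + b)) :
  (i < j)%N -> (@part_index n p I i < @part_index n p I j)%N.
Proof.
rewrite /part_index; case: (splitP i) => k ->; case: (splitP j) => l -> /=.
- exact: ltn_enum_val.
- by move=> _; apply: ltn_addr.
- by rewrite ltnNge (leq_trans (ltnW (ltn_ord l)) (leq_addr _ _)).
- by rewrite !ltn_add2l => /ltn_enum_val.
Qed.

Lemma part_index_mono :
  {mono @part_index n p I : i j / (i < j)%N}.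
Proof.
move=> i j; apply/idP/idP; last exact: part_index_homo.
case: (ltngtP i j) => // [ji|/val_inj->]; last by rewrite ltnn.
by rewrite ltnNge ltnW // part_index_homo.
Qed.

Lemma part_index_inj : injective (@part_index n p I).
Proof.
move=> i j e; case: (ltngtP i j) => [||/val_inj//];
  by rewrite -part_index_mono e ltnn.
Qed.

Lemma part_index_lshift k : @part_index n p I (lshift b k) = lshift p (enum_val k).
Proof. by rewrite /part_index -[lshift b k]/(unsplit (inl k)) unsplitK. Qed.

Lemma part_index_rshift k : @part_index n p I (rshift a k) = rshift n (enum_val k).
Proof. by rewrite /part_index -[rshift a k]/(unsplit (inr k)) unsplitK. Qed.

Lemma mem_part_index i : @part_index n p I i \in I.
Proof.
rewrite /part_index; case: (splitP i) => k _.
- by have := enum_valP k; rewrite inE.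
- by have := enum_valP k; rewrite inE.
Qed.

Lemma part_index_surj i : i \in I -> exists l, i = @part_index n p I l.
Proof.
rewrite -[i]splitK; case: (split i) => k /= kI.
- have kI' : k \in mutable_part I by rewrite inE.
  by exists (lshift b (enum_rank_in kI' k)); rewrite part_index_lshift enum_rankK_in.
- have kI' : k \in frozen_part I by rewrite inE.
  by exists (rshift a (enum_rank_in kI' k)); rewrite part_index_rshift enum_rankK_in.
Qed.

Lemma enum_part : enum I = map (@part_index n p I) (enum 'I_(a + b)).
Proof.
apply: eq_enum_ord => [|i].
  rewrite sorted_map; apply: sub_sorted (sorted_enum_ord _) => i j /=.
  by rewrite part_index_mono.
apply/idP/mapP => [/part_index_surj[l ->]|[l _ ->]]; last exact: mem_part_index.
by exists l; rewrite ?mem_enum.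
Qed.

(** Since [part_index] enumerates [I] increasingly, both sides multiply the same factors in the same
    order, with the same power of [h]. *)
Lemma normalized_monomial_part (F : unitRingType) (h : F) (L : 'M[int]_(n + p))
    (x : {ffun 'I_(n + p) -> F}) (e : 'cV[int]_(n + p)) (f : 'cV[int]_(a + b)) :
  (forall i, i \notin I -> e i 0 = 0) ->
  (forall l, e (@part_index n p I l) 0 = f l 0) ->
  normalized_monomial h (mxsub (@part_index n p I) (@part_index n p I) L)
    [ffun i => x (@part_index n p I i)] f = normalized_monomial h L x e.
Proof.
move=> e0 ef; rewrite (@normalized_monomial_support _ _ _ _ _ _ I)//.
rewrite (@normalized_monomial_support _ _ _ _ _ f predT)//.
rewrite enum_part; congr (h ^ (- _) * _); rewrite [RHS]big_map; last first.
  by apply: eq_bigr => i _; rewrite ffunE ef.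
apply: eq_bigr => i _; rewrite [RHS]big_map.
under [RHS]eq_bigl do rewrite part_index_mono.
by apply: eq_bigr => j _; rewrite !ef mxE.
Qed.

(** The half of block-diagonality that mutations in the directions of [I] see: it constrains only
    the columns indexed by [I]. *)
Definition isolated (B : 'M[int]_(n + p, n)) :=
  forall i k, i \notin I -> lshift p k \in I -> B i k = 0.

(** In a row [i] outside [I] the factor sgn(b_ik) is 0, so the correction term of the mutation
    vanishes. *)
Lemma isolated_mutate B k :
  isolated B -> lshift p k \in I -> isolated (mutate_exchange B k).
Proof.
move=> isoB kI i j iI jI; rewrite mxE (isoB i k) // (isoB i j) //.
by rewrite sgr0 mul0r addr0 oppr0 if_same.
Qed.

(** The column b_k of a direction in [I] is supported in [I]. Hence both exchange monomials, and the
    sum giving the new row of [L], involve only indices of [I]. *)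
Lemma part_seed_mutate (F : unitRingType) (h : F) (s : qseed F n p) k :
  isolated (exchange_matrix s) ->
  mutate h (part_seed I s) k = part_seed I (mutate h s (enum_val k)).
Proof.
move=> isoB; have kI : lshift p (enum_val k) \in I.
  by rewrite -part_index_lshift mem_part_index.
have eqk i : (@part_index n p I i == lshift p (enum_val k)) = (i == lshift b k).
  by rewrite -part_index_lshift (inj_eq part_index_inj).
rewrite /mutate /part_seed /=; congr QSeed.
- apply/ffunP => i; rewrite !ffunE eqk; case: eqP => // _.
  rewrite /mutate_variable /seed_monomial /=.
  congr (_ + _); apply: normalized_monomial_part => l.
  + move=> lI; rewrite !mxE isoB //.
    case: eqP lI => [->|_ _]; first by rewrite kI.
    by rewrite /= oppr0 add0r.
  + by rewrite !mxE eqk.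
  + move=> lI; rewrite !mxE isoB //.
    case: eqP lI => [->|_ _]; first by rewrite kI.
    by rewrite /= oppr0 add0r.
  + by rewrite !mxE eqk.
- apply/matrixP => i j; rewrite !mxE eqk (inj_eq enum_val_inj).
  by rewrite part_index_lshift.
- have row_part j : - quasi_commutation s (lshift p (enum_val k)) (@part_index n p I j)
      + \sum_l pos_part (exchange_matrix s l (enum_val k))
          * quasi_commutation s l (@part_index n p I j)
    = - (mxsub (@part_index n p I) (@part_index n p I) (quasi_commutation s)) (lshift b k) j
      + \sum_l pos_part (part_exchange I (exchange_matrix s) l k)
          * (mxsub (@part_index n p I) (@part_index n p I) (quasi_commutation s)) l j.
    rewrite mxE part_index_lshift; congr (_ + _).
    rewrite (bigID (mem I)) /= [X in _ + X]big1 ?addr0; last first.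
      by move=> l lI; rewrite isoB // /pos_part maxxx mul0r.
    rewrite -big_enum enum_part big_map big_enum; apply: eq_bigr => l _.
    by rewrite !mxE.
  by apply/matrixP => i j; rewrite !mxE !eqk !row_part !mxE.
Qed.

Lemma mutations_part_seed (F : unitRingType) (h : F) (s : qseed F n p) ks :
  isolated (exchange_matrix s) ->
  mutations h (part_seed I s) ks = part_seed I (mutations h s (map enum_val ks)).
Proof.
elim: ks s => //= k ks IH s isoB.
rewrite /mutations /= -!/(mutations _ _ _) part_seed_mutate // IH //.
apply: isolated_mutate => //.
by rewrite -part_index_lshift mem_part_index.
Qed.

(** Each seed of the subalgebra is the restriction of a seed of the whole algebra, so a submatrix of
    the Poisson matrix there serves. *)
Lemma compatible_part (F : unitRingType) (h : F) br (s : qseed F n p) :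
  isolated (exchange_matrix s) -> compatible h br s ->
  compatible h br (part_seed I s).
Proof.
move=> isoB comp ks; have [W WP] := comp (map enum_val ks).
exists (mxsub (@part_index n p I) (@part_index n p I) W) => i j.
rewrite mutations_part_seed // [extended_cluster _]/= !ffunE mxE.
have [sW ->] := WP (@part_index n p I i) (@part_index n p I j); split => //.
congr (_ * _); symmetry; apply: normalized_monomial_part => l.
  have neq k : l \notin I -> l == @part_index n p I k = false.
    by apply: contraNF => /eqP->; apply: mem_part_index.
  by move=> lI; rewrite !mxE !neq.
by rewrite !mxE !(inj_eq part_index_inj).
Qed.

End PartIndex.

(** * Mutation of compatible pairs *)

Lemma pos_partB (a : int) : pos_part a - pos_part (- a) = a.
Proof. by rewrite /pos_part; lia. Qed.

Lemma pos_partM (a b : int) : 0 <= a -> pos_part (a * b) = a * pos_part b.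
Proof. by move=> a0; rewrite /pos_part maxr_pMr // mulr0. Qed.

(** With a = b_ik and b = b_kj, this splits the correction term of matrix mutation into [b_ik]_+
    b_kj, a row operation, and b_ik [-b_kj]_+, a column operation. *)
Lemma sgr_pos_part (a b : int) :
  Num.sg a * pos_part (a * b) - pos_part a * b = a * pos_part (- b).
Proof.
rewrite /pos_part.
case: (ltgtP a 0) => [a0|a0|->]; [rewrite ltr0_sg //|rewrite gtr0_sg //|rewrite sgr0; lia].
all: case: (leP 0 b) => b0; nia.
Qed.

Section CompatiblePair.
Variables (n p : nat).
Implicit Types (B : 'M[int]_(n + p, n)) (L : 'M[int]_(n + p)).

(** B^T L B equals D times the square part of [B], and it inherits skew-symmetry from [L]. For a
    mutated pair only B'^T L' then has to be computed. *)
Lemma compatible_pair_skew B L (D : 'rV[int]_n) :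
  L^T = - L -> B^T *m L = row_mx (diag_mx D) 0 ->
  (diag_mx D *m usubmx B)^T = - (diag_mx D *m usubmx B).
Proof.
move=> Lskew BL.
have <- : B^T *m L *m B = diag_mx D *m usubmx B.
  by rewrite BL -{1}[B]vsubmxK mul_row_col mul0mx addr0.
by rewrite !trmx_mul Lskew trmxK mulNmx mulmxN mulmxA.
Qed.

Lemma row_mx_diagE (D : 'rV[int]_n) i (j : 'I_(n + p)) :
  (row_mx (diag_mx D) 0 : 'M_(n, n + p)) i j = D 0 i * (lshift p i == j)%:R.
Proof.
rewrite mxE; case: (splitP j) => k jk; rewrite !mxE.
  have -> : j = lshift p k by apply/val_inj.
  by rewrite (inj_eq (@lshift_inj _ _)) mulr_natr.
have -> : j = rshift n k by apply/val_inj.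
by rewrite eq_lrshift mulr0.
Qed.

Section Mutate.
Variables (B : 'M[int]_(n + p, n)) (L : 'M[int]_(n + p)) (k : 'I_n).
Local Notation K := (lshift p k).

(* [E] replaces the basis vector e_k by [b_k]_+ - e_k.  When B K k = 0,
   [E *m mutate_exchange B k] is B up to a column operation, so
   B'^T L' = (E B')^T L E reduces to B^T L. *)
Let u : 'cV[int]_(n + p) :=
  \col_i (pos_part (B i k) - (i == K)%:R *+ 2).
Let c : 'rV[int]_n := \row_j (if j == k then - 2%:R else pos_part (- B K j)).
Let E : 'M[int]_(n + p) := 1%:M + u *m delta_mx 0 K.

(** Mutation negates row [K], so adding u_i times that row cancels the row operation of
    [sgr_pos_part] and leaves the column operation. The entry -2 of [c] accounts for the negated
    column [k]. *)
Lemma mutate_exchangeE : B K k = 0 ->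
  E *m mutate_exchange B k = B *m (1%:M + delta_mx k 0 *m c).
Proof.
move=> BKk; rewrite mulmxDl mulmxDr mul1mx mulmx1 -mulmxA.
rewrite [B *m _]mulmxA -rowE -colE.
apply/matrixP => i j; rewrite !mxE !big_ord1 !mxE eqxx /=.
case: (j =P k) => [->|_]; first rewrite !orbT.
  by rewrite BKk; lia.
case: (i =P K) => [->|_]; rewrite ?orbF /=.
  by rewrite BKk /pos_part maxxx; lia.
by rewrite subr0 mulrN -addrA sgr_pos_part.
Qed.

(** [E] is a rank-one perturbation of the identity, and the quadratic term u^T L u vanishes by
    skew-symmetry. What remains alters only row and column [K]. *)
Lemma mutate_commutationE : L^T = - L ->
  mutate_commutation B L k = E^T *m L *m E.
Proof.
move=> Lskew.
have LN i j : L i j = - L j i by rewrite -[L in LHS]trmxK Lskew !mxE.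
have uLu : u^T *m L *m u = 0.
  apply/matrixP => i j; rewrite !ord1 [RHS]mxE.
  have : (u^T *m L *m u)^T 0 0 = - (u^T *m L *m u) 0 0.
    by rewrite !trmx_mul trmxK Lskew mulNmx mulmxN mulmxA mxE.
  by rewrite mxE; lia.
have Ln : L *m u = - (u^T *m L)^T by rewrite trmx_mul trmxK Lskew mulNmx opprK.
have -> : E^T *m L *m E =
    L + (delta_mx 0 K)^T *m (u^T *m L) - (u^T *m L)^T *m delta_mx 0 K.
  have -> : E^T = 1%:M + (delta_mx 0 K)^T *m u^T.
    by rewrite /E linearD /= trmx1 trmx_mul.
  rewrite mulmxDr mulmx1 mulmxDl mul1mx mulmxDl.
  have -> : (delta_mx 0 K)^T *m u^T *m L *m (u *m delta_mx 0 K) = 0.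
    by rewrite -!mulmxA [L *m _]mulmxA [u^T *m _]mulmxA [u^T *m _]mulmxA uLu mul0mx mulmx0.
  by rewrite addr0 [L *m (u *m _)]mulmxA Ln mulNmx -mulmxA.
have uL j : (u^T *m L) 0 j = - L K j *+ 2 + \sum_l pos_part (B l k) * L l j.
  rewrite mxE addrC (eq_bigr (fun l => pos_part (B l k) * L l j -
    (l == K)%:R *+ 2 * L l j)); last by move=> l _; rewrite !mxE mulrBl.
  rewrite sumrB mulNrn; congr (_ - _).
  rewrite (bigD1 K) //= big1 ?addr0 ?eqxx ?mulr_natl //.
  by move=> l /negPf->; rewrite mul0rn mul0r.
move: (u^T *m L) uL => r uL.
apply/matrixP => i j; rewrite !mxE !big_ord1 !mxE !uL !eqxx /=.
case: eqP => [->|_]; case: eqP => [->|_]; rewrite ?mulr0 ?mulr1 ?mul0r ?mul1r.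
- by have := LN K K; lia.
- lia.
- by have := LN i K; lia.
- lia.
Qed.

Lemma compatible_pair_mutate : compatible_pair B L ->
  compatible_pair (mutate_exchange B k) (mutate_commutation B L k).
Proof.
case=> D [D0 DB Lskew BL]; have DBE i : D 0 i * B (lshift p i) k = - (D 0 k * B K i).
  by move/matrixP/(_ k i): DB; rewrite mul_diag_mx !mxE.
(* A diagonal entry of the skew matrix DB is zero, and D_k > 0. *)
have BKk : B K k = 0 by have := DBE k; have := D0 k; nia.
have L'skew : (mutate_commutation B L k)^T = - mutate_commutation B L k.
  by rewrite mutate_commutationE // !trmx_mul trmxK Lskew mulNmx mulmxN mulmxA.
have B'L' : (mutate_exchange B k)^T *m mutate_commutation B L k = row_mx (diag_mx D) 0.
  rewrite mutate_commutationE // !mulmxA -trmx_mul mutate_exchangeE //.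
  rewrite trmx_mul -[_ *m B^T *m L]mulmxA BL.
  have SE i j : ((row_mx (diag_mx D) 0 : 'M_(n, n + p)) *m E) i j = D 0 i * E (lshift p i) j.
    rewrite mxE (bigD1 (lshift p i)) //= row_mx_diagE eqxx mulr1 big1 ?addr0 //.
    by move=> l /negPf; rewrite eq_sym row_mx_diagE => ->; rewrite mulr0 mul0r.
  have -> : (1%:M + delta_mx k 0 *m c)^T = 1%:M + c^T *m delta_mx 0 k.
    by rewrite linearD /= trmx1 trmx_mul trmx_delta.
  rewrite -mulmxA mulmxDl mul1mx -mulmxA -rowE; apply/matrixP => i j.
  rewrite mxE SE [in X in _ + X]mxE big_ord1 [(row _ _) _ _]mxE SE row_mx_diagE.
  rewrite !mxE !big_ord1 !mxE !eqxx /=.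
  case: (j =P K) => [->|/eqP/negPf jK]; last first.
    by rewrite [K == j]eq_sym jK; lia.
  rewrite [K == K]eqxx (inj_eq (@lshift_inj _ _)) BKk [pos_part 0]maxxx.
  case: (i =P k) => [->|_] /=; first by rewrite BKk [pos_part 0]maxxx; lia.
  have Di := ltW (D0 i); have Dk := ltW (D0 k).
  (* Off the diagonal, the entry in column [K] is D_i [b_ik]_+ - D_k [-b_ki]_+, because [E] has
     entry -1 at (K, K). It vanishes because DB is skew. *)
  have : D 0 i * pos_part (B (lshift p i) k) = D 0 k * pos_part (- B K i).
    by rewrite -!pos_partM ?ltW ?D0 // DBE mulrN.
  lia.
by exists D; split => //; apply: compatible_pair_skew B'L'.
Qed.

End Mutate.
End CompatiblePair.

(** * Commutation up to a power of q, and commutators of cluster elements *)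

Section CentralUnit.
Variables (F : unitRingType) (h : F).
Hypotheses (hC : forall x, h * x = x * h) (hU : h \is a GRing.unit).

Lemma exprz_central (z : int) x : h ^ z * x = x * h ^ z.
Proof. by symmetry; apply: commrXz; symmetry; apply: hC. Qed.

Lemma exprz_centralA (z : int) x y : x * (h ^ z * y) = h ^ z * (x * y).
Proof. by rewrite !mulrA exprz_central. Qed.

Lemma laurent_scalar_comm c x : laurent_scalar h c -> c * x = x * c.
Proof.
move=> [N [P ->]]; symmetry; apply: commrM.
  by apply: commrV; apply: commrX; symmetry; apply: hC.
apply: commr_horner; first by symmetry; apply: hC.
by move=> i; rewrite coef_map; symmetry; apply: commr_int.
Qed.

Lemma horner_scaleXn (M : nat) (P : {poly int}) :
  (map_poly intr ('X^M * P)).[h] = h ^+ M * (map_poly intr P).[h] :> F.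
Proof. by rewrite rmorphM /= map_polyXn hornerM_comm ?hornerXn //; apply: hC. Qed.

Lemma laurent_scalarD x y :
  laurent_scalar h x -> laurent_scalar h y -> laurent_scalar h (x + y).
Proof.
move=> [N [P ->]] [M [Q ->]]; exists (N + M)%N, ('X^M * P + 'X^N * Q).
rewrite rmorphD hornerD !horner_scaleXn mulrDr.
congr (_ + _); first rewrite addnC; rewrite exprD invrM ?unitrX // -mulrA;
  by rewrite mulKr ?unitrX.
Qed.

Lemma laurent_scalarN x : laurent_scalar h x -> laurent_scalar h (- x).
Proof. by move=> [N [P ->]]; exists N, (- P); rewrite rmorphN hornerN mulrN. Qed.

Lemma laurent_scalarXz (z : int) x :
  laurent_scalar h x -> laurent_scalar h (h ^ z * x).
Proof.
move=> [N [P ->]]; case: z => M.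
  exists N, ('X^M * P); rewrite horner_scaleXn !mulrA; congr (_ * _).
  by symmetry; apply: commrX; symmetry; apply: commrV; apply: commrX.
exists (N + M.+1)%N, P; rewrite exprD invrM ?unitrX // mulrA.
by rewrite NegzE -exprnN.
Qed.

Definition quasi_commute (z : int) x y := x * y = h ^ z * (y * x).

Lemma quasi_commuteM x y z w t :
  quasi_commute z x t -> quasi_commute w y t -> quasi_commute (z + w) (x * y) t.
Proof.
rewrite /quasi_commute => xt yt; rewrite -mulrA yt exprz_centralA [x * _]mulrA xt.
by rewrite !mulrA -exprzDr // addrC.
Qed.

Lemma quasi_commuteV x z t : x \is a GRing.unit ->
  quasi_commute z x t -> quasi_commute (- z) x^-1 t.
Proof.
rewrite /quasi_commute => xU xt; apply: (mulrI xU); rewrite mulVKr //.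
rewrite exprz_centralA [x * _]mulrA xt -!mulrA mulrV // mulr1 mulrA -exprzDr //.
by rewrite addNr expr0z mul1r.
Qed.

Lemma quasi_commute1 t : quasi_commute 0 1 t.
Proof. by rewrite /quasi_commute expr0z !mul1r mulr1. Qed.

Lemma quasi_commuteXz x z t (k : int) : x \is a GRing.unit ->
  quasi_commute z x t -> quasi_commute (k * z) (x ^ k) t.
Proof.
move=> xU xt; have natX (m : nat) : quasi_commute (m%:Z * z) (x ^+ m) t.
  elim: m => [|m IH]; first by rewrite mul0r; apply: quasi_commute1.
  by rewrite exprS intS mulrDl mul1r; apply: quasi_commuteM.
case: k => m; first exact: natX.
by rewrite NegzE -exprnN mulNr; apply: quasi_commuteV; rewrite ?unitrX.
Qed.

Lemma quasi_commuteC z x y : quasi_commute z x y -> quasi_commute (- z) y x.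
Proof. by rewrite /quasi_commute => ->; rewrite mulrA -exprzDr // addNr expr0z mul1r. Qed.

(** Exponents count powers of [h], which stands for q^{1/2}. The relation X_i X_j = q^{l_ij} X_j X_i
    therefore carries the doubled entry. *)
Definition quasi_commuting m (L : 'M[int]_m) (x : 'I_m -> F) :=
  (forall i, x i \is a GRing.unit) /\
  forall i j, quasi_commute (L i j *+ 2) (x i) (x j).

Lemma normalized_monomial_unit m L (x : {ffun 'I_m -> F}) e :
  quasi_commuting L x -> normalized_monomial h L x e \is a GRing.unit.
Proof.
move=> [xU _]; rewrite unitrMr ?unitrXz //.
by apply: (big_rec (fun y => y \is a GRing.unit)) => [|i y _]; rewrite ?unitr1 // unitrMr ?unitrXz.
Qed.

Lemma quasi_commute_monomial m L (x : {ffun 'I_m -> F}) (e : 'cV[int]_m) j :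
  quasi_commuting L x ->
  quasi_commute ((\sum_i e i 0 * L i j) *+ 2) (normalized_monomial h L x e) (x j).
Proof.
move=> [xU xL]; rewrite /normalized_monomial.
rewrite -[_ *+ 2]add0r; apply: quasi_commuteM.
  by rewrite /quasi_commute expr0z mul1r exprz_central.
rewrite -sumrMnl; apply: (big_rec2 (fun s y => quasi_commute s y (x j))).
  exact: quasi_commute1.
move=> i s y _ sy; apply: quasi_commuteM sy.
by rewrite -mulrnAr; apply: quasi_commuteXz.
Qed.

(** Both x_i x_j and x_j x_i are multiples of the same normalized monomial, by h^{l_ij} and
    h^{-l_ij}. *)
Lemma commutator_monomial m L (x : {ffun 'I_m -> F}) i j :
  quasi_commuting L x -> L^T = - L ->
  x i * x j - x j * x i = (h ^ L i j - h ^ (- L i j)) *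
    normalized_monomial h L x (delta_mx i 0 + delta_mx j 0).
Proof.
move=> qc Lskew; have [_ xL] := qc.
have LN k l : L k l = - L l k by rewrite -[L in LHS]trmxK Lskew !mxE.
(* The explicit form of the monomial needs i < j; both sides change sign under exchange of i and
   j. *)
wlog ij : i j / (i < j)%N => [IH|].
  case: (ltngtP i j) => [/IH//|ji|/val_inj->]; last first.
    have -> : L j j = 0 by have := LN j j; lia.
    by rewrite subrr oppr0 subrr mul0r.
  by rewrite -opprB IH // -mulNr opprB (LN i j) opprK [delta_mx i 0 + _]addrC.
rewrite normalized_monomial_pair // mulrA mulrBl -!exprzDr // subrr expr0z.
rewrite mulrBl mul1r; congr (_ - _).
have := xL j i; rewrite /quasi_commute => ->; rewrite (LN j i) mulr2n.
by rewrite -opprD.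
Qed.
End CentralUnit.

(** * The exchange identity between a Poisson bracket and the commutator *)

Lemma poisson_commutator (F : unitRingType) (h : F) (A : F -> Prop) br a b c d :
  poisson_bracket h A br ->
  (forall x y, A x -> A y -> A (x + y)) -> (forall x y, A x -> A y -> A (x * y)) ->
  A a -> A b -> A c -> A d ->
  br a c * (b * d - d * b) = (a * c - c * a) * br b d.
Proof.
move=> pb AD AM Aa Ab Ac Ad.
have ls1 : laurent_scalar h 1.
  by exists 0%N, 1; rewrite rmorph1 hornerC expr0 invr1 mul1r.
have brDl x y z : A x -> A y -> A z -> br (x + y) z = br x z + br y z.
  by move=> *; rewrite -{1}[x]mul1r (pb_linearl pb) // mul1r.
have brDr x y z : A x -> A y -> A z -> br z (x + y) = br z x + br z y.
  by move=> *; rewrite -{1}[x]mul1r (pb_linearr pb) // mul1r.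
have brN x y : A x -> A y -> br x y = - br y x.
  move=> Ax Ay; apply/eqP; rewrite -addr_eq0; apply/eqP.
  have Axy := AD _ _ Ax Ay; have := pb_alternating pb Axy.
  by rewrite brDl // !brDr // !(pb_alternating pb) // add0r addr0.
have brMl x y z : A x -> A y -> A z -> br (x * y) z = br x z * y + x * br y z.
  move=> Ax Ay Az; rewrite (brN (x * y) z) ?(pb_leibniz pb) //; last exact: AM.
  rewrite opprD -mulNr -mulrN.
  by rewrite -!brN.
have brMr := pb_leibniz pb.
(* The two expansions of {ab, cd}: on the left the second argument is split first, on the right the
   first argument. *)
have : br (a * b) c * d + c * br (a * b) d = br a (c * d) * b + a * br b (c * d).
  by rewrite -brMr ?brMl //; apply: AM.
rewrite !brMr // !brMl // !(mulrDl, mulrDr) !mulrA => E.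
rewrite !(mulrN, mulNr) !mulrA.
(* The common terms a{b,c}d and c{a,d}b are moved to the front of both sides and then cancelled. *)
rewrite [LHS](AC (2*2) ((2*3)*(1*4))) [RHS](AC (2*2) ((3*2)*(4*1))) in E.
by apply/eqP; rewrite subr_eq addrAC eq_sym subr_eq; apply/eqP/esym/(addrI _ E).
Qed.

(** * Quasi-commutation under seed mutation *)

Section Division.
Variables (F : unitRingType) (h : F).
Hypotheses (hC : forall x, h * x = x * h) (hU : h \is a GRing.unit).
Hypothesis divF : forall x : F, x != 0 -> x \is a GRing.unit.
Hypothesis h_free : forall z : int, h ^ z = 1 -> z = 0.

Lemma quasi_commuteD z x y t :
  quasi_commute h z x t -> quasi_commute h z y t -> quasi_commute h z (x + y) t.
Proof. by rewrite /quasi_commute mulrDl !mulrDr => -> ->. Qed.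

(** Two exponents z, w for the same units give h^{z-w} = 1, and [h] is not a root of unity. *)
Lemma quasi_commute_inj z w x y : x \is a GRing.unit -> y \is a GRing.unit ->
  quasi_commute h z x y -> quasi_commute h w x y -> z = w.
Proof.
rewrite /quasi_commute => xU yU -> /mulIr E; apply/eqP; rewrite -subr_eq0.
apply/eqP/h_free; rewrite exprzDr // E ?unitrMl //.
by rewrite -exprzDr // subrr expr0z.
Qed.

(** The exponents of the two exchange monomials differ by b_k. By B^T L = (D 0), they quasi-commute
    in the same way with every x_j, j different from [K], and so does their sum. *)
Lemma quasi_commuting_mutate n p (s : qseed F n p) k :
  let s' := mutate h s k in
  compatible_pair (exchange_matrix s) (quasi_commutation s) ->
  quasi_commuting h (quasi_commutation s) (extended_cluster s) ->
  quasi_commuting h (quasi_commutation s') (extended_cluster s').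
Proof.
move=> s' [D [D0 _ Lskew BL]] qc; have [xU xL] := qc.
set B := exchange_matrix s in BL; set L := quasi_commutation s in BL Lskew qc xL.
set x := extended_cluster s in qc xU xL; set K := lshift p k.
pose b : bool -> 'cV[int]_(n + p) := fun e => if e then col k B else - col k B.
pose f e := - delta_mx K 0 + map_mx pos_part (b e).
pose M e := seed_monomial h s (f e).
pose r e j := \sum_i f e i 0 * L i j.
have Mx e j : quasi_commute h (r e j *+ 2) (M e) (x j).
  exact: quasi_commute_monomial.
have rB j : r true j - r false j = D 0 k * (K == j)%:R.
  rewrite -row_mx_diagE -BL mxE -sumrB; apply: eq_bigr => i _.
  by rewrite -mulrBl !mxE /= opprD addrACA subrr add0r pos_partB.
have rE j : r true j = - L K j + \sum_l pos_part (B l k) * L l j.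
  rewrite /r (eq_bigr (fun i => pos_part (B i k) * L i j - (i == K)%:R * L i j)).
    rewrite sumrB addrC; congr (- _ + _).
    by rewrite (bigD1 K) //= big1 ?addr0 ?eqxx ?mul1r // => i /negPf->; rewrite mul0r.
  by move=> i _; rewrite !mxE eqxx andbT mulrDl mulNr addrC.
have MU e : M e \is a GRing.unit by exact: normalized_monomial_unit.
have x'E : mutate_variable h s k = M true + M false by [].
have x'U : mutate_variable h s k \is a GRing.unit.
  (* If the sum were zero, the monomials would be opposite and quasi-commute with x_K by the same
     power of [h]; but these exponents differ by 2 D_k > 0. *)
  rewrite x'E; apply: divF; apply/eqP => /eqP; rewrite addr_eq0 => /eqP Meq.
  have MK : quasi_commute h (r false K *+ 2) (M true) (x K).
    by rewrite /quasi_commute Meq mulNr mulrN (Mx false K) mulrN.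
  have := quasi_commute_inj (MU true) (xU K) (Mx true K) MK.
  by have := rB K; rewrite eqxx; have := D0 k; lia.
have x'x j : j != K -> quasi_commute h (r true j *+ 2) (mutate_variable h s k) (x j).
  move=> jK; rewrite x'E; apply: quasi_commuteD => //.
  by have := rB j; rewrite eq_sym (negPf jK) mulr0 => /eqP; rewrite subr_eq0 => /eqP->.
split=> [i|i j]; first by rewrite ffunE; case: ifP.
rewrite !ffunE !mxE; case: eqP => [_|/eqP iK]; case: eqP => [_|/eqP jK] //.
- by rewrite /quasi_commute expr0z mul1r.
- by rewrite -rE; apply: x'x.
- by rewrite -rE mulNrn; apply: quasi_commuteC => //; apply: x'x.
Qed.

Lemma mutations_rcons n p (s : qseed F n p) ks k :
  mutations h s (rcons ks k) = mutate h (mutations h s ks) k.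
Proof. by rewrite /mutations foldl_rcons. Qed.

Lemma mutations_frozen n p (s : qseed F n p) ks j :
  extended_cluster (mutations h s ks) (rshift n j) = extended_cluster s (rshift n j).
Proof.
by elim/last_ind: ks => // ks k IH; rewrite mutations_rcons ffunE eq_rlshift.
Qed.

Lemma extended_cluster_mem n p (s : qseed F n p) ks i :
  cluster_algebra h s (extended_cluster (mutations h s ks) i).
Proof.
rewrite -[i]splitK; case: (split i) => j /=; first exact: cluster_algebra_variable.
by rewrite mutations_frozen; apply: cluster_algebra_frozen.
Qed.

(** The entries of the mutated matrix are integer combinations of the old ones, so they stay in any
    subgroup [G] of the integers containing those. *)
Lemma mutate_commutation_closed n p (G : int -> Prop) (B : 'M[int]_(n + p, n))
    (L : 'M[int]_(n + p)) k :
  G 0 -> (forall z w, G z -> G w -> G (z + w)) -> (forall z, G z -> G (- z)) ->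
  (forall i j, G (L i j)) -> forall i j, G (mutate_commutation B L k i j).
Proof.
move=> G0 GD GN GL.
have Gz (c : int) z : G z -> G (c * z).
  move=> Gz; have Gn (m : nat) : G (m%:Z * z).
    by elim: m => [|m IH]; rewrite ?mul0r // intS mulrDl mul1r; apply: GD.
  by case: c => m; rewrite ?NegzE ?mulNr; auto.
have Grow j : G (- L (lshift p k) j + \sum_l pos_part (B l k) * L l j).
  apply: (GD); first exact: GN.
  by apply: (big_ind G) => [||l _]; [exact: G0 | exact: GD | exact: Gz].
by move=> i j; rewrite mxE; do 2!case: eqP => _ //; apply: GN.
Qed.

End Division.

(** * Units and quasi-commutation in the skew field of the quantum torus *)

Section QuantumTorusFacts.
Variables (F : unitRingType) (h : F) (m : nat) (L : 'M[int]_m).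
Variable X : 'cV[int]_m -> F.
Hypothesis qt : quantum_torus_skew_field h L X.

Lemma torus_expn_inj (a b : nat) : h ^+ a = h ^+ b -> a = b.
Proof.
move=> E; have /(qt_formal qt) : (map_poly intr ('X^a - 'X^b : {poly int})).[h] = 0 :> F.
  by rewrite rmorphB /= !map_polyXn hornerD hornerN !hornerXn E subrr.
move=> /(congr1 (fun P : {poly int} => P`_a)); rewrite coefB !coefXn coef0 eqxx.
by case: eqP.
Qed.

Lemma torus_h_unit : h \is a GRing.unit.
Proof.
apply: (qt_division qt); apply/eqP => h0.
by have := @torus_expn_inj 1 2; rewrite h0 !expr0n => /(_ erefl).
Qed.

Lemma torus_h_free (z : int) : h ^ z = 1 -> z = 0.
Proof.
case: z => a; first by move=> E; rewrite (@torus_expn_inj a 0).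
by rewrite NegzE -exprnN => /(canRL (@invrK _)); rewrite invr1 => /(@torus_expn_inj _ 0).
Qed.

Lemma torus_monomial_unit e : X e \is a GRing.unit.
Proof.
apply: (qt_division qt); apply/eqP => Xe0.
have ls1 : laurent_scalar h 1.
  by exists 0%N, 1; rewrite rmorph1 hornerC expr0 invr1 mul1r.
have := qt_free qt (s := [:: e]) (c := fun=> 1) isT (fun=> ls1).
rewrite big_seq1 Xe0 mulr0 => /(_ erefl e); rewrite inE eqxx => /(_ isT)/eqP.
by rewrite oner_eq0.
Qed.

Lemma torus_quasi_commuting : L^T = - L ->
  quasi_commuting h L (fun i => X (delta_mx i 0)).
Proof.
move=> Lskew; split=> [i|i j]; first exact: torus_monomial_unit.
have pairE k l : pairing L (delta_mx k 0) (delta_mx l 0) = L k l.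
  by rewrite /pairing trmx_delta -rowE -colE !mxE.
have LN : L j i = - L i j by rewrite -[L in LHS]trmxK Lskew !mxE.
rewrite /quasi_commute !(qt_mul qt) !pairE LN mulrA -exprzDr ?torus_h_unit //.
by rewrite mulr2n addrK [delta_mx j 0 + _]addrC.
Qed.

End QuantumTorusFacts.

(** * Brackets that are log-canonical on the initial cluster *)

Section LogCanonical.
Variables (F : unitRingType) (n p : nat).
Variables (B : 'M[int]_(n + p, n)) (L : 'M[int]_(n + p)).
Variables (h : F) (X : 'cV[int]_(n + p) -> F).
Variables (br : F -> F -> F) (Omega : 'M[F]_(n + p)).
Local Notation s0 := (initial_seed X B L).
Local Notation A := (cluster_algebra h s0).
Hypothesis BL : compatible_pair B L.
Hypothesis qt : quantum_torus_skew_field h L X.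
Hypothesis pb : poisson_bracket h A br.
Hypothesis lc : log_canonical h br s0 Omega.

Let hC := qt_central qt.
Let hU := torus_h_unit qt.

(** Otherwise the diagonal entry of B^T L in row [k], which is D_k > 0, would be a sum of zeros. *)
Lemma compatible_pair_neq0 (k : 'I_n) : exists t, L t (lshift p k) != 0.
Proof.
case: BL => D [D0 _ _ /matrixP/(_ k (lshift p k))].
rewrite row_mx_diagE eqxx mulr1 mxE => E.
case: (pickP (fun t => L t (lshift p k) != 0)) => [t Lt|L0]; first by exists t.
have := D0 k; rewrite -E big1 ?ltxx // => t _.
by have /negbFE/eqP-> := L0 t; rewrite mulr0.
Qed.

Lemma initial_quasi_commuting : quasi_commuting h L (extended_cluster s0).
Proof.
case: BL => D [_ _ Lskew _]; have [XU XL] := torus_quasi_commuting qt Lskew.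
by split=> [i|i j]; rewrite !ffunE.
Qed.

Lemma bracket_commutator (k : 'I_n) :
  exists a, forall b d, A b -> A d -> br b d = a * (b * d - d * b).
Proof.
have [t Lt] := compatible_pair_neq0 k; set K := lshift p k in Lt.
have [D [_ _ Lskew _]] := BL.
have memA i : A (extended_cluster s0 i) := extended_cluster_mem h s0 [::] i.
have AD x y : A x -> A y -> A (x + y) by apply: cluster_algebra_add.
have AM x y : A x -> A y -> A (x * y) by apply: cluster_algebra_mul.
set w := h ^ L t K - h ^ (- L t K).
have wC x : w * x = x * w by rewrite mulrBl mulrBr !(exprz_central hC).
have wU : w \is a GRing.unit.
  apply: (qt_division qt); rewrite subr_eq0; apply: contra Lt => /eqP E.
  have /(torus_h_free qt) : h ^ (L t K + L t K) = 1.
    by rewrite exprzDr // {1}E -exprzDr // addNr expr0z.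
  by move=> ?; apply/eqP; lia.
(* This is the quotient of {X_t, X_K} by [X_t, X_K]: both are multiples of one normalized monomial,
   which cancels, and [w] is central. The quotient lies in [F] and need not be a Laurent
   polynomial. *)
exists (w^-1 * Omega t K) => b d Ab Ad.
have [OC brX] := lc t K.
have := poisson_commutator pb AD AM (memA t) Ab (memA K) Ad.
rewrite brX (commutator_monomial hU _ _ initial_quasi_commuting Lskew) -/w.
rewrite (laurent_scalar_comm hC _ OC) wC -[LHS]mulrA -[RHS]mulrA.
have MU := normalized_monomial_unit hU (delta_mx t 0 + delta_mx K 0) initial_quasi_commuting.
by move=> /(mulrI MU) E; apply: (mulrI wU); rewrite -E !mulrA divrr ?mul1r.
Qed.

Lemma log_canonical_scalar a :
  (forall b d, A b -> A d -> br b d = a * (b * d - d * b)) ->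
  forall i j, Omega i j = a * (h ^ L i j - h ^ (- L i j)).
Proof.
move=> brE i j; have [_] := lc i j; have [D [_ _ Lskew _]] := BL.
have memA l : A (extended_cluster s0 l) := extended_cluster_mem h s0 [::] l.
rewrite brE // (commutator_monomial hU _ _ initial_quasi_commuting Lskew).
rewrite mulrA => /esym; apply: mulIr.
exact: normalized_monomial_unit initial_quasi_commuting.
Qed.

Lemma log_canonical_compatible : compatible h br s0.
Proof.
(* The empty sequence is the hypothesis on the initial cluster; a nonempty one supplies the mutable
   index from which [a] is built. *)
case=> [|k ks]; first by exists Omega.
have [a brE] := bracket_commutator k.
pose G z := laurent_scalar h (a * (h ^ z - h ^ (- z))).
have inv (s := mutations h s0 (k :: ks)) :
  [/\ compatible_pair (exchange_matrix s) (quasi_commutation s),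
      quasi_commuting h (quasi_commutation s) (extended_cluster s)
    & forall i j, G (quasi_commutation s i j)].
  rewrite {}/s; elim/last_ind: (k :: ks) => [|ls l [BLs qcs Gs]].
    split=> // [|i j]; first exact: initial_quasi_commuting.
    by rewrite /G -log_canonical_scalar //; case: (lc i j).
  rewrite mutations_rcons; split; first exact: compatible_pair_mutate.
    apply: quasi_commuting_mutate => //; first exact: qt_division qt.
    exact: torus_h_free qt.
  apply: mutate_commutation_closed => // [|z w Gz Gw|z].
  - by rewrite /G subrr mulr0; exists 0%N, 0; rewrite rmorph0 horner0 mulr0.
  (* Telescoping: h^{z+w} - h^{-z-w} = h^w (h^z - h^{-z}) + h^{-z} (h^w - h^{-w}). *)
  - have -> : G (z + w) = laurent_scalar h (h ^ w * (a * (h ^ z - h ^ (- z)))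
        + h ^ (- z) * (a * (h ^ w - h ^ (- w)))).
      rewrite /G -!(exprz_centralA hC) -mulrDr !mulrBr -!exprzDr // opprD.
      by rewrite [w + z]addrC [- z + w]addrC addrA subrK -mulrBr.
    exact: (laurent_scalarD hC hU (laurent_scalarXz hC hU w Gz)
      (laurent_scalarXz hC hU (- z) Gw)).
  - by move=> /(laurent_scalarN); rewrite -mulrN opprB /G opprK.
move: inv; set s := mutations _ _ _ => -[[D [_ _ Lskew _]] qcs Gs].
(* The Poisson matrix of the mutated cluster is read off from the commutator formula for its own
   quasi-commutation matrix. *)
exists (\matrix_(i, j) (a * (h ^ quasi_commutation s i j
  - h ^ (- quasi_commutation s i j)))) => i j.
rewrite mxE; split; first exact: Gs.
rewrite brE; [|exact: extended_cluster_mem|exact: extended_cluster_mem].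
by rewrite (commutator_monomial hU _ _ qcs Lskew) mulrA.
Qed.

End LogCanonical.

Theorem proposition5p2 (F : unitRingType) (n p : nat)
    (B : 'M[int]_(n + p, n)) (L : 'M[int]_(n + p))
    (h : F) (X : 'cV[int]_(n + p) -> F)
    (br : F -> F -> F) (Omega : 'M[F]_(n + p))
    (P : {set {set 'I_(n + p)}}) :
  compatible_pair B L ->
  quantum_torus_skew_field h L X ->
  poisson_bracket h (cluster_algebra h (initial_seed X B L)) br ->
  log_canonical h br (initial_seed X B L) Omega ->
  decomposition B P ->
  (forall I, I \in P -> ~ decomposable (part_exchange I B)) ->
  (compatible h br (initial_seed X B L) <->
   (forall I, I \in P -> compatible h br (part_seed I (initial_seed X B L))) /\
   (forall (k : 'I_n) (j : 'I_(n + p)), j \notin pblock P (lshift p k) ->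
      \sum_(t | L t j == 0) Omega t j * (B t k)%:~R = 0)).
Proof.
move=> BL qt pb lc [/and3P[/eqP covP trivP _] decP] _.
have comp := log_canonical_compatible BL qt pb lc.
split=> // _; split=> [I IP|k j _].
  apply: compatible_part comp => i k iI kI; apply: decP.
  (* The block of a mutable index in [I] is [I] itself, so a row outside [I] lies in another
     block. *)
  rewrite (def_pblock trivP IP kI); apply: contra iI => /eqP <-.
  by rewrite mem_pblock covP inE.
have [a brE] := bracket_commutator BL qt pb lc k.
(* Each summand vanishes separately: omega_tj = a (h^0 - h^0) when l_tj = 0. *)
apply: big1 => t /eqP Lt0.
by rewrite (log_canonical_scalar BL qt lc brE) Lt0 subrr mulr0 mul0r.
Qed.
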